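(* Let $p\ge2$ and let $\varphi:\mathbb{R}^n\to\mathbb{R}\cup\{+\infty\}$ be proper and lower semicontinuous. Suppose $\bar x=0$ is a $p$-calm point of $\varphi$ with constant $M>0$, $\varphi(0)=0$, and $\varphi$ is $q$-prox-regular with some $q\ge p$ at $\bar x=0$ for $\bar\zeta=0\in\partial\varphi(0)$ with constants $\varepsilon<\frac12$ and $\rho>0$. Then for each $\gamma\in\big(0,\min\{\frac{2^{1-p}}{Mp},\frac1{\rho2^{2p-3}}\}\big)$ there exists a neighborhood $U\subseteq\mathbb{B}(0;\varepsilon)$ such that $$\|\operatorname{prox}^p_{\gamma\varphi}(x_2)-\operatorname{prox}^p_{\gamma\varphi}(x_1)\|\le L_p\|x_2-x_1\|^{1/q}\quad\forall x_1,x_2\in U,$$ and $\varphi^p_\gamma$ is differentiable on $U$ with $$\|\nabla\varphi^p_\gamma(x_2)-\nabla\varphi^p_\gamma(x_1)\|\le\mathcal{L}_p\|x_2-x_1\|^{1/q}\quad\forall x_1,x_2\in U,$$ where $s=\frac p{p-1}$, $L_p:=\Big(\frac{2(1+\frac{2^p}{\kappa_s})\varepsilon^{p-1}}{\frac1{2^{2p-3}}-\gamma\rho}\Big)^{1/q}$ and $\mathcal{L}_p:=\frac{2(2\varepsilon)^{p-2}}{\gamma\kappa_s}\big((2\varepsilon)^{\frac{q-1}q}+L_p\big)$.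
   Context: $\operatorname{prox}^p_{\gamma\varphi}(x):=\operatorname{argmin}_{y}\big(\varphi(y)+\frac{1}{p\gamma}\|x-y\|^p\big)$, $\varphi^p_\gamma(x):=\inf_y\big(\varphi(y)+\frac{1}{p\gamma}\|x-y\|^p\big)$. $\bar x$ is a $p$-calm point with constant $M>0$ if $\varphi(x)+M\|x-\bar x\|^p>\varphi(\bar x)$ for all $x\neq\bar x$. $\partial$ is the Mordukhovich (limiting) subdifferential. $\varphi$ is $q$-prox-regular ($q\ge2$) at $\bar x$ for $\bar\zeta\in\partial\varphi(\bar x)$ with constants $\varepsilon>0,\rho\ge0$ if $\varphi(x')\ge\varphi(x)+\langle\zeta,x'-x\rangle-\frac\rho2\|x'-x\|^q$ for all $x'\in\mathbb{B}(\bar x;\varepsilon)$, whenever $x\in\mathbb{B}(\bar x;\varepsilon)$, $\zeta\in\partial\varphi(x)\cap\mathbb{B}(\bar\zeta;\varepsilon)$, $\varphi(x)<\varphi(\bar x)+\varepsilon$. The constant $\kappa_t$ ($t\in(1,2]$) is: $\kappa_t=\frac{(2+\sqrt3)(t-1)}{16}$ for $t\in(1,\hat t]$, $\kappa_t=\frac{2+\sqrt3}{16}(1-(3-\sqrt3)^{1-t})$ for $t\in[\hat t,2)$, $\kappa_2=1$, where $\hat t\approx1.3214$ solves $\frac{t(t-1)}2=1-\big[1+\frac{(2-\sqrt3)t}{t-1}\big]^{1-t}$ on $(1,2]$. *)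

(* Defs.v *)
From HB Require Import structures.
From mathcomp Require Import all_boot all_order all_algebra.
From mathcomp Require Import all_classical all_reals all_analysis.
Set Implicit Arguments. Unset Strict Implicit. Unset Printing Implicit Defensive.
Import Order.TTheory GRing.Theory Num.Theory.
Local Open Scope classical_set_scope.
Local Open Scope ring_scope.

Section Defs.
Context {R : realType} {n : nat}.
Local Notation vec := 'rV[R]_n.

Definition dot (u v : vec) : R := \sum_(i < n) u ord0 i * v ord0 i.
Definition enorm (u : vec) : R := Num.sqrt (dot u u).

Definition cball (c : vec) (r : R) : set vec := [set x | enorm (x - c) <= r].

Definition vcvg (u : nat -> vec) (l : vec) : Prop :=
  forall e : R, 0 < e -> exists N : nat, forall k : nat, (N <= k)%N -> enorm (u k - l) < e.
Definition rcvg (u : nat -> R) (l : R) : Prop :=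
  forall e : R, 0 < e -> exists N : nat, forall k : nat, (N <= k)%N -> `|u k - l| < e.

Definition proper_fun (f : vec -> \bar R) : Prop :=
  (forall x, f x != -oo%E) /\ (exists x, f x \is a fin_num).

Definition lsc (f : vec -> \bar R) : Prop :=
  forall x (a : R), (a%:E < f x)%E ->
    exists d : R, 0 < d /\ forall y, enorm (y - x) < d -> (a%:E < f y)%E.

Definition regular_subdiff (f : vec -> \bar R) (x : vec) : set vec :=
  [set v | f x \is a fin_num /\
     forall e : R, 0 < e -> exists d : R, 0 < d /\ forall y, enorm (y - x) < d ->
       ((fine (f x) + dot v (y - x) - e * enorm (y - x))%:E <= f y)%E].

Definition limiting_subdiff (f : vec -> \bar R) (x : vec) : set vec :=
  [set v | f x \is a fin_num /\
     exists (xk vk : nat -> vec),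
       vcvg xk x /\ rcvg (fun k => fine (f (xk k))) (fine (f x)) /\
       (forall k, regular_subdiff f (xk k) (vk k)) /\ vcvg vk v].

Definition p_calm (f : vec -> \bar R) (xbar : vec) (p M : R) : Prop :=
  forall x, x != xbar -> (f xbar < f x + (M * enorm (x - xbar) `^ p)%:E)%E.

Definition q_prox_regular (f : vec -> \bar R) (xbar zetabar : vec) (q eps rho : R)
  : Prop :=
  limiting_subdiff f xbar zetabar /\
  forall x zeta, cball xbar eps x -> limiting_subdiff f x zeta ->
    cball zetabar eps zeta -> (f x < f xbar + eps%:E)%E ->
    forall x', cball xbar eps x' ->
      ((fine (f x) + dot zeta (x' - x) - rho / 2 * enorm (x' - x) `^ q)%:E
        <= f x')%E.

Definition prox_obj (f : vec -> \bar R) (p gamma : R) (x y : vec) : \bar R :=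
  (f y + (enorm (x - y) `^ p / (p * gamma))%:E)%E.
Definition prox (f : vec -> \bar R) (p gamma : R) (x : vec) : set vec :=
  [set y | forall z, (prox_obj f p gamma x y <= prox_obj f p gamma x z)%E].
Definition envelope (f : vec -> \bar R) (p gamma : R) (x : vec) : \bar R :=
  ereal_inf [set prox_obj f p gamma x y | y in [set: vec]].

Definition has_gradient (f : vec -> \bar R) (x g : vec) : Prop :=
  f x \is a fin_num /\
  forall e : R, 0 < e -> exists d : R, 0 < d /\ forall y, enorm (y - x) < d ->
    f y \is a fin_num /\
    `|fine (f y) - fine (f x) - dot g (y - x)| <= e * enorm (y - x).

End Defs.

Definition kappa {R : realType} (that t : R) : R :=
  if t == 2 then 1
  else if t <= that then (2 + Num.sqrt 3) * (t - 1) / 16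
  else (2 + Num.sqrt 3) / 16 * (1 - (3 - Num.sqrt 3) `^ (1 - t)).

Definition that_eqn {R : realType} (t : R) : Prop :=
  1 < t <= 2 /\
  t * (t - 1) / 2 = 1 - (1 + (2 - Num.sqrt 3) * t / (t - 1)) `^ (1 - t).

(* Main.v *)
(** Put J(a) = |a|^(p-2) a. On the ball of radius r it is (p-1) r^(p-2)-Lipschitz,
    it is uniformly monotone, <J a - J b, a - b> >= 2^(1-p) |a - b|^p, and
    J/gamma is the gradient of the convex penalty |.|^p/(p gamma). Calmness at 0
    makes the proximal objective coercive, so a minimizer y exists and
    |x - y| <= C |x|. For small x the subgradient J(x - y)/gamma of phi at y is
    therefore within reach of prox-regularity; adding the two instances at
    minimizers y1, y2 gives
      <J(x2 - y2) - J(x1 - y1), y2 - y1> >= - gamma rho |y2 - y1|^q,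
    and inserting J(x1 - y2) bounds |y2 - y1|^q by a multiple of |x2 - x1|.
    The envelope is squeezed between two tangents of the penalty, hence has
    gradient J(x - y)/gamma. The constants of the theorem follow from
    p - 1 <= 1/kappa_s, which holds since s - 1 = 1/(p - 1). *)

Require Import Defs.
From HB Require Import structures.
From mathcomp Require Import all_boot all_order all_algebra.
From mathcomp Require Import all_classical all_reals all_analysis.
From mathcomp Require Import ring lra.
Import Order.TTheory GRing.Theory Num.Theory.
Import numFieldNormedType.Exports.
Local Open Scope classical_set_scope.
Local Open Scope ring_scope.

(** * Scalar inequalities for real powers and the bound on [kappa] *)

Section PowR.
Context {R : realType}.
Implicit Types a b m p r : R.

Lemma ler_powR_base {r a b} : 0 <= r -> 0 <= a -> a <= b -> a `^ r <= b `^ r.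
Proof.
move=> r0 a0 ab; apply: ge0_ler_powR => //; rewrite nnegrE //.
exact: le_trans ab.
Qed.

Lemma powR_le_self {a p} : 0 <= a -> a <= 1 -> 1 <= p -> a `^ p <= a.
Proof.
rewrite le_eqVlt => /predU1P[<- _ p1|a0 a1 p1]; first by rewrite powR0//; lra.
by apply: ge1r_powR => //; rewrite a0.
Qed.

Lemma mulr_powRB2 {a p} : 0 <= a -> 1 < p -> a `^ (p - 2) * a = a `^ (p - 1).
Proof.
move=> a0 p1; rewrite mulrC -(@mulr_powRB1 _ a (p - 1)) //; last by lra.
by congr (_ * _ `^ _); lra.
Qed.

(** Young's inequality with conjugate exponents [p / (p - 1)] and [p], applied to [a ^ (p - 1)] and
    [b]; it says that [t ^ p] lies above its tangent at [a]. *)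
Lemma powR_tangent {a b p} : 0 <= a -> 0 <= b -> 1 < p ->
  p * a `^ (p - 1) * b <= (p - 1) * a `^ p + b `^ p.
Proof.
move=> a0 b0 p1.
have p0 : 0 < p by lra.
have pn0 : p != 0 by rewrite gt_eqF.
have pm0 : 0 < p - 1 by lra.
have pmn0 : p - 1 != 0 by rewrite gt_eqF.
have := @conjugate_powR _ (a `^ (p - 1)) b (p / (p - 1)) p (powR_ge0 _ _) b0
  (divr_gt0 p0 pm0) p0.
have -> : (p / (p - 1))^-1 + p^-1 = 1 by field; rewrite pn0 pmn0.
rewrite -powRrM [(p - 1) * _]mulrC mulfVK // => /(_ erefl) H.
have -> : (p - 1) * a `^ p + b `^ p =
    p * (a `^ p / (p / (p - 1)) + b `^ p / p).
  by field; rewrite pn0 pmn0.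
by rewrite -mulrA ler_pM2l.
Qed.

(** The tangents of [t ^ p] at the midpoint [c], evaluated at [a] and at [b], add up to
    [2 * c ^ p <= a ^ p + b ^ p]. *)
Lemma powRD_le {a b p} : 0 <= a -> 0 <= b -> 1 < p ->
  (a + b) `^ p <= 2 `^ (p - 1) * (a `^ p + b `^ p).
Proof.
move=> a0 b0 p1; pose c := (a + b) / 2.
have c0 : 0 <= c by rewrite /c; lra.
have ca := powR_tangent c0 a0 p1; have cb := powR_tangent c0 b0 p1.
have cc : c * c `^ (p - 1) = c `^ p by rewrite mulr_powRB1//; lra.
have two : 2 * 2 `^ (p - 1) = 2 `^ p :> R by rewrite mulr_powRB1//; lra.
have -> : a + b = 2 * c by rewrite /c; field.
rewrite powRM // -two -mulrA [2 * (_ * _)]mulrCA ler_pM2l ?powR_gt0 //.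
have abc : a + b = 2 * c by rewrite /c; field.
have : p * c `^ (p - 1) * (a + b) = 2 * p * c `^ p by rewrite abc -cc; ring.
rewrite mulrDr => abE; lra.
Qed.

(* With t = b / a this is (1 - t^m) t <= m (1 - t), from
   t^m = exp (- m ln (1/t)) >= 1 - m (1/t - 1). *)
Lemma powRB_le {a b m} : 0 <= b -> b <= a -> 0 <= m ->
  (a `^ m - b `^ m) * b <= m * a `^ m * (a - b).
Proof.
rewrite le_eqVlt => /predU1P[<- a0 m0|b0 ba m0].
  by rewrite mulr0 subr0 !mulr_ge0 ?powR_ge0.
have a0 : 0 < a by apply: lt_le_trans ba.
have an0 : a != 0 by rewrite gt_eqF.
have bn0 : b != 0 by rewrite gt_eqF.
have ab : a = b * (a / b) by field.
have lnab : ln (a / b) <= a / b - 1.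
  have := @le_ln1Dx _ (a / b - 1); rewrite [1 + _]addrC subrK; apply.
  by rewrite ltrBrDr addNr divr_gt0.
have bE : b `^ m = a `^ m * expR (- (m * ln (a / b))).
  rewrite /powR !gt_eqF // -expRD ln_div ?posrE //; congr expR; ring.
have bm : a `^ m * (1 - m * (a / b - 1)) <= b `^ m.
  rewrite bE ler_pM2l ?powR_gt0 //; apply: le_trans (expR_ge1Dx _).
  by rewrite lerD2l lerN2 ler_wpM2l.
have -> : m * a `^ m * (a - b) = (m * (a / b - 1) * a `^ m) * b by field.
rewrite ler_pM2r //; lra.
Qed.

(** Each branch of [kappa] is at most [s - 1 = 1 / (p - 1)]: the factor [(2 + sqrt 3) / 16] is below
    1, and with [v = s - 1] the last branch uses [1 - exp (- v ln (3 - sqrt 3)) <= v ln (3 - sqrt 3)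
    <= v]. Positivity comes from [3 - sqrt 3 > 1]. *)
Lemma kappa_le {that p} : 2 <= p ->
  0 < kappa that (p / (p - 1)) /\ (p - 1) * kappa that (p / (p - 1)) <= 1.
Proof.
move=> p2; have pm0 : p - 1 != 0 by rewrite gt_eqF//; lra.
have r3 : 1 < Num.sqrt 3 :> R by rewrite -[ltLHS]sqrtr1 ltr_sqrt; lra.
have r32 : Num.sqrt 3 < 2 :> R.
  by rewrite -[ltRHS]ger0_norm// -sqrtr_sqr ltr_sqrt ?exprn_gt0//; lra.
rewrite /kappa; move: (Num.sqrt 3) r3 r32 => w r3 r32.
have sE : p / (p - 1) - 1 = (p - 1)^-1 by field.
have sE' : 1 - p / (p - 1) = - (p - 1)^-1 by field.
have s0 : 0 < (p - 1)^-1 by rewrite invr_gt0; lra.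
have ss : (p - 1) * (p - 1)^-1 = 1 by rewrite divff.
case: eqP => [s2|_].
  have : p = 2 * (p - 1) by rewrite -s2 mulfVK.
  lra.
rewrite sE sE'; set v := (p - 1)^-1 in s0 ss *; case: ifP => _.
  split; first by rewrite divr_gt0// mulr_gt0//; lra.
  by rewrite mulrA mulrCA ss; lra.
have ln0 : 0 < ln (3 - w) by apply: ln_gt0; lra.
have ln1 : ln (3 - w) <= 1.
  have := @le_ln1Dx _ (2 - w); have -> : 1 + (2 - w) = 3 - w by ring.
  by move=> H; apply: le_trans (H _) _; lra.
have vln0 : 0 < v * ln (3 - w) by rewrite mulr_gt0.
have vln1 : v * ln (3 - w) <= v by rewrite -[leRHS]mulr1 ler_pM2l.
have powE : (3 - w) `^ (- v) = expR (- (v * ln (3 - w))).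
  by rewrite /powR gt_eqF ?mulNr//; lra.
have pow1 : (3 - w) `^ (- v) < 1 by rewrite powE -[ltRHS]expR0 ltr_expR; lra.
have pow0 : 1 - (3 - w) `^ (- v) <= v.
  by rewrite powE; have := expR_ge1Dx (- (v * ln (3 - w))); lra.
split; first by apply: mulr_gt0; lra.
rewrite mulrCA -[leRHS](mulr1); apply: ler_pM; try lra.
  by rewrite mulr_ge0; lra.
by rewrite -[leRHS]ss ler_pM2l //; lra.
Qed.

End PowR.

(** * Euclidean inner product and norm on row vectors *)

Section Euclid.
Context {R : realType} {n : nat}.
Implicit Types (u v w : 'rV[R]_n) (k : R).

Lemma dotC u v : dot u v = dot v u.
Proof. by apply: eq_bigr => i _; rewrite mulrC. Qed.

Lemma dotDl u v w : dot (u + v) w = dot u w + dot v w.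
Proof. by rewrite -big_split; apply: eq_bigr => i _; rewrite mxE mulrDl. Qed.

Lemma dotZl k u v : dot (k *: u) v = k * dot u v.
Proof. by rewrite mulr_sumr; apply: eq_bigr => i _; rewrite mxE mulrA. Qed.

Lemma dotNl u v : dot (- u) v = - dot u v.
Proof. by rewrite -scaleN1r dotZl mulN1r. Qed.

Lemma dotBl u v w : dot (u - v) w = dot u w - dot v w.
Proof. by rewrite dotDl dotNl. Qed.

Lemma dotDr u v w : dot w (u + v) = dot w u + dot w v.
Proof. by rewrite !(dotC w) dotDl. Qed.

Lemma dotNr u v : dot v (- u) = - dot v u.
Proof. by rewrite !(dotC v) dotNl. Qed.

Lemma dotBr u v w : dot w (u - v) = dot w u - dot w v.
Proof. by rewrite dotDr dotNr. Qed.

Lemma dotZr k u v : dot v (k *: u) = k * dot v u.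
Proof. by rewrite !(dotC v) dotZl. Qed.

Definition dotE := (dotDl, dotDr, dotNl, dotNr, dotZl, dotZr).

Lemma dot_ge0 u : 0 <= dot u u.
Proof. by apply: sumr_ge0 => i _; rewrite -expr2 sqr_ge0. Qed.

Lemma enorm_ge0 u : 0 <= enorm u. Proof. exact: sqrtr_ge0. Qed.

Lemma dotuu u : dot u u = enorm u ^+ 2.
Proof. by rewrite sqr_sqrtr ?dot_ge0. Qed.

Lemma le_enorm_sqr u k : 0 <= k -> dot u u <= k ^+ 2 -> enorm u <= k.
Proof. by move=> k0; rewrite dotuu ler_sqr ?nnegrE ?enorm_ge0. Qed.

Lemma enormN u : enorm (- u) = enorm u.
Proof. by rewrite /enorm !dotE opprK. Qed.

Lemma enormB u v : enorm (u - v) = enorm (v - u).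
Proof. by rewrite -enormN opprB. Qed.

Lemma enormZ k u : enorm (k *: u) = `|k| * enorm u.
Proof.
by rewrite /enorm !dotE mulrA -expr2 sqrtrM ?sqr_ge0 // sqrtr_sqr.
Qed.

Lemma enorm0 : enorm (0 : 'rV[R]_n) = 0.
Proof. by rewrite -(scale0r 0) enormZ normr0 mul0r. Qed.

Lemma enorm_coord u i : `|u ord0 i| <= enorm u.
Proof.
rewrite -sqrtr_sqr ler_wsqrtr // /dot (bigD1 i) //= -expr2 lerDl.
by apply: sumr_ge0 => j _; rewrite -expr2 sqr_ge0.
Qed.

Lemma enorm_eq0 {u} : enorm u = 0 -> u = 0.
Proof.
move=> u0; apply/rowP => i; rewrite mxE; apply/eqP.
by rewrite -normr_le0 -u0 enorm_coord.
Qed.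

Lemma dot_le u v : dot u v <= enorm u * enorm v.
Proof.
have := enorm_ge0 v; rewrite le_eqVlt => /predU1P[v0|v0].
  by rewrite -v0 mulr0 (enorm_eq0 (esym v0)) -(scale0r 0) dotZr mul0r.
have := enorm_ge0 u; rewrite le_eqVlt => /predU1P[u0|u0].
  by rewrite -u0 mul0r (enorm_eq0 (esym u0)) -(scale0r 0) dotZl mul0r.
(* Expanding this square gives Cauchy-Schwarz multiplied by [2 |u| |v|], which is positive once the
   zero vectors are set aside. *)
have := dot_ge0 (enorm v *: u - enorm u *: v).
rewrite !dotE !dotuu (dotC v u) => H.
rewrite -subr_ge0 -(pmulr_rge0 _ (mulr_gt0 u0 v0)); nra.
Qed.

Lemma dot_geN u v : - (enorm u * enorm v) <= dot u v.
Proof. by rewrite lerNl -dotNl -(enormN u) dot_le. Qed.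

Lemma enormD u v : enorm (u + v) <= enorm u + enorm v.
Proof.
apply: le_enorm_sqr; first by rewrite addr_ge0 ?enorm_ge0.
rewrite !dotE (dotC v u) !dotuu; have := dot_le u v; nra.
Qed.

Lemma enormB_le u v : enorm (u - v) <= enorm u + enorm v.
Proof. by rewrite -(enormN v) enormD. Qed.

Lemma enorm_dist u v w : enorm (u - w) <= enorm (u - v) + enorm (v - w).
Proof. by have := enormD (u - v) (v - w); rewrite addrA subrK. Qed.

Lemma subDB u v w : (u - v) - (u - w) = w - v.
Proof. by rewrite opprB addrC addrA subrK. Qed.

Lemma subDBr u v w : (u - w) - (v - w) = u - v.
Proof. by rewrite opprB addrA subrK. Qed.

(** The ambient topology is that of entrywise balls. An entrywise ball of radius [c = k / (n + 1)]
    fits because [n * c ^ 2 < (n + 1) ^ 2 * c ^ 2], also when [n = 0]. *)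
Lemma nbhs_enorm u k : 0 < k -> nbhs u [set v | enorm (v - u) < k].
Proof.
move=> k0.
have [c c0 kE] : exists2 c : R, 0 < c & k = n.+1%:R * c.
  by exists (k / n.+1%:R); rewrite ?divr_gt0 // mulrC mulfVK.
apply: (@filterS _ _ _ (ball u c)); last exact: nbhsx_ballx.
move=> v [_ uv] /=.
have sq : dot (v - u) (v - u) < k ^+ 2.
  apply: (@le_lt_trans _ _ (\sum_(i < n) c ^+ 2)).
    apply: ler_sum => i _; rewrite -expr2 -real_normK ?num_real //.
    rewrite ler_sqr ?nnegrE ?normr_ge0 ?(ltW c0) //.
    by have := uv ord0 i; rewrite /ball/= !mxE distrC => /ltW.
  rewrite sumr_const card_ord -mulr_natl.
  rewrite kE exprMn ltr_pM2r ?exprn_gt0 // -natrX ltr_nat.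
  by rewrite (@leq_trans n.+1) // leq_pmulr.
by rewrite -(ger0_norm (ltW k0)) -sqrtr_sqr /enorm ltr_sqrt // exprn_gt0.
Qed.

End Euclid.

Section PowerMap.
Context {R : realType} {n : nat} {p : R} (p2 : 2 <= p).
Implicit Types (u v w : 'rV[R]_n) (r : R).

Definition powmap u := enorm u `^ (p - 2) *: u.

Let p0 : 0 < p. Proof. exact: lt_le_trans p2. Qed.
Let p1 : 1 < p. Proof. by apply: lt_le_trans p2; rewrite ltr1n. Qed.
Let m0 : 0 <= p - 2. Proof. by rewrite subr_ge0. Qed.

Lemma enorm_powmap u : enorm (powmap u) = enorm u `^ (p - 1).
Proof.
by rewrite enormZ ger0_norm ?powR_ge0 // mulr_powRB2 ?enorm_ge0.
Qed.

Lemma dot_powmap u : dot (powmap u) u = enorm u `^ p.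
Proof.
rewrite dotZl dotuu expr2 mulrA mulr_powRB2 ?enorm_ge0 // mulrC.
by rewrite mulr_powRB1 ?enorm_ge0.
Qed.

(** For [|v| <= |u|], split [J u - J v] into [|u| ^ (p - 2) (u - v)] and a change of scale along
    [v]. The first part contributes 1 to the factor [p - 1], the second contributes [p - 2] through
    [powRB_le]. *)
Lemma powmap_lipschitz r u v : enorm u <= r -> enorm v <= r ->
  enorm (powmap u - powmap v) <= (p - 1) * r `^ (p - 2) * enorm (u - v).
Proof.
wlog vu : u v / enorm v <= enorm u => [H ur vr|ur _].
  have [/H|/ltW/H] := leP (enorm v) (enorm u); first exact.
  by rewrite (enormB (powmap u)) (enormB u); apply.
set a := enorm u in vu ur; set b := enorm v in vu.
have b0 : 0 <= b := enorm_ge0 v.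
have -> : powmap u - powmap v =
    a `^ (p - 2) *: (u - v) + (a `^ (p - 2) - b `^ (p - 2)) *: v.
  by rewrite /powmap -/a -/b scalerBr scalerBl addrA subrK.
have ba : b `^ (p - 2) <= a `^ (p - 2) by exact: ler_powR_base.
have ar : a `^ (p - 2) <= r `^ (p - 2).
  by apply: ler_powR_base => //; exact: le_trans vu.
have d0 := enorm_ge0 (u - v).
have abd : a - b <= enorm (u - v).
  by have := enormD (u - v) v; rewrite subrK lerBlDr.
apply: (@le_trans _ _ ((p - 1) * a `^ (p - 2) * enorm (u - v))); last first.
  by rewrite ler_wpM2r // ler_wpM2l // subr_ge0 ltW.
apply: le_trans (enormD _ _) _; rewrite !enormZ !ger0_norm ?powR_ge0 ?subr_ge0//.
have : (p - 2) * a `^ (p - 2) * (a - b) <=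
       (p - 2) * a `^ (p - 2) * enorm (u - v).
  by rewrite ler_wpM2l // mulr_ge0 ?powR_ge0.
have := powRB_le b0 vu m0; rewrite -/b; lra.
Qed.

(* With [a = |u| >= b = |v|], the left-hand side of the polarization
   identity below is at least [a `^ (p - 2) * |u - v| ^+ 2 / 2], and
   [|u - v| <= 2 * a]. *)
Lemma powmap_monotone u v :
  2 `^ (1 - p) * enorm (u - v) `^ p <= dot (powmap u - powmap v) (u - v).
Proof.
wlog vu : u v / enorm v <= enorm u => [H|].
  have [/H|/ltW/H] := leP (enorm v) (enorm u); first exact.
  by rewrite (enormB u) -(opprB v u) -(opprB (powmap v)) dotNl dotNr opprK.
set a := enorm u in vu *; set b := enorm v in vu *; set d := enorm (u - v).
have b0 : 0 <= b := enorm_ge0 v.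
have d0 : 0 <= d := enorm_ge0 (u - v).
have ba : b `^ (p - 2) <= a `^ (p - 2) by exact: ler_powR_base.
have polar : dot (powmap u - powmap v) (u - v) =
    (a `^ (p - 2) + b `^ (p - 2)) * d ^+ 2 / 2 +
    (a `^ (p - 2) - b `^ (p - 2)) * (a ^+ 2 - b ^+ 2) / 2.
  by rewrite /a /b /d -!dotuu /powmap !dotE (dotC v u); field.
have dE : 2 `^ (1 - p) * d `^ p = (d / 2) `^ (p - 2) * d ^+ 2 / 2.
  have -> : 1 - p = - (p - 2) + - 1 by ring.
  have half : 2^-1 `^ (p - 2) = 2 `^ (- (p - 2)) :> R.
    by rewrite -(@powR_inv1 _ 2) // -powRrM mulN1r.
  rewrite powRM ?invr_ge0 // half (@powRD _ 2) ?pnatr_eq0 ?implybT //.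
  rewrite powR_inv1 // -(@mulr_powRB1 _ d p) // -(@mulr_powRB2 _ d p) // expr2.
  by ring.
have da : (d / 2) `^ (p - 2) <= a `^ (p - 2).
  apply: ler_powR_base => //; first by rewrite divr_ge0.
  by have := enormB_le u v; rewrite -/a -/b -/d; lra.
have := powR_ge0 b (p - 2).
rewrite polar dE => B0.
have h1 : 0 <= (a `^ (p - 2) - b `^ (p - 2)) * (a ^+ 2 - b ^+ 2).
  by rewrite mulr_ge0 // subr_ge0 // ler_sqr // nnegrE // (le_trans b0).
have h2 : (d / 2) `^ (p - 2) * d ^+ 2 <= a `^ (p - 2) * d ^+ 2.
  by rewrite ler_wpM2r ?sqr_ge0.
have h3 : 0 <= b `^ (p - 2) * d ^+ 2 by rewrite mulr_ge0 ?sqr_ge0.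
lra.
Qed.

(** Cauchy-Schwarz reduces the claim to the scalar tangent inequality between [|u|] and [|v|]. *)
Lemma powmap_tangent u v :
  enorm u `^ p + p * dot (powmap u) (v - u) <= enorm v `^ p.
Proof.
rewrite dotBr dot_powmap.
have Jv : dot (powmap u) v <= enorm u `^ (p - 1) * enorm v.
  by apply: le_trans (dot_le _ _) _; rewrite enorm_powmap.
have := powR_tangent (enorm_ge0 u) (enorm_ge0 v) p1.
have : p * dot (powmap u) v <= p * (enorm u `^ (p - 1) * enorm v).
  by rewrite ler_pM2l.
lra.
Qed.

End PowerMap.
Arguments powmap {R n} p u.

(** * Attainment of minima of lower semicontinuous functions on compact sets *)

Section LowerSemicontinuous.
Context {R : realType} {n : nat}.
Implicit Types (f : 'rV[R]_n -> \bar R) (K : set 'rV[R]_n).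

Lemma lte_EFin_dense (a : R) (b : \bar R) : (a%:E < b)%E ->
  exists c : R, a < c /\ (c%:E < b)%E.
Proof.
case: b => [b||] //; last by exists (a + 1); rewrite ltrDl ltr01 ltry.
by rewrite lte_fin => ab; exists ((a + b) / 2); rewrite lte_fin !midf_lt.
Qed.

Lemma lsc_near {f} x (a : R) : lsc f -> (a%:E < f x)%E ->
  \forall y \near x, (a%:E < f y)%E.
Proof.
by move=> + ax => /(_ x a ax) [d [d0 df]]; apply: filterS (nbhs_enorm x d d0).
Qed.

(** If the infimum [m] were not attained, every point of [K] would have a neighbourhood on which [f]
    exceeds some level above [m]. Compactness makes one level serve all of [K], against the
    definition of [m]. The bounds by [c] and by [f x0] make [m] finite. *)
Lemma lsc_attains_min {f K} x0 (c : R) : lsc f -> compact K -> K x0 ->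
  f x0 \is a fin_num -> (forall x, K x -> (c%:E <= f x)%E) ->
  exists2 x, K x & forall z, K z -> (f x <= f z)%E.
Proof.
move=> lf cK Kx0 fx0 fc.
pose m := ereal_inf (f @` K).
have mf x : K x -> (m <= f x)%E by move=> Kx; apply: ereal_inf_lbound; exists x.
have cm : (c%:E <= m)%E by apply: le_ereal_inf_tmp => _ [x Kx <-]; exact: fc.
have mfin : m \is a fin_num.
  rewrite fin_numElt (lt_le_trans (ltNyr c) cm) /=.
  by apply: le_lt_trans (mf _ Kx0) _; rewrite ltey_eq fx0.
have [[x Kx fxm]|nomin] := pselect (exists2 x, K x & (f x <= m)%E).
  by exists x => // z Kz; apply: le_trans fxm (mf _ Kz).
have lt_mf x : K x -> (m < f x)%E.
  by move=> Kx; rewrite ltNge; apply/negP => fxm; apply: nomin; exists x.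
have /compact_near_coveringP cov := cK.
(* Compactness in near-covering form, the parameter being a level [i] that decreases to [m]. *)
have : \forall i \near (fine m)^'+, K `<=` (fun x => (i%:E < f x)%E).
  apply: (cov _ _ (fun i x => (i%:E < f x)%E)) => x Kx.
  have [a [ma af]] : exists a, fine m < a /\ (a%:E < f x)%E.
    by apply: lte_EFin_dense; rewrite fineK // lt_mf.
  exists ([set y | (a%:E < f y)%E], [set i | i < a]) => /=.
    by split; [exact: lsc_near | exact: nbhs_right_lt].
  by move=> [y i] [/= ay ia]; apply: lt_trans ay; rewrite lte_fin.
move=> near_inf.
have [i [mi /= Ki]] : exists i, fine m < i /\ K `<=` (fun x => (i%:E < f x)%E).
  near (fine m)^'+ => i; exists i; split; last by near: i.
  by near: i; exact: nbhs_right_gt.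
have : (i%:E <= m)%E by apply: le_ereal_inf_tmp => _ [x /Ki/ltW ? <-].
by rewrite -(fineK mfin) lee_fin leNgt mi.
Unshelve. all: by end_near.
Qed.

End LowerSemicontinuous.

(** * Linear arithmetic for the subgradient and envelope estimates *)

Section SlopeArithmetic.
Context {R : realType}.

Lemma slope_arith {Fy Fz hy hz a b k e : R} :
  Fy + hy <= Fz + hz -> hz + a <= hy -> - k <= a - b -> k <= e ->
  Fy + b - e <= Fz.
Proof. lra. Qed.

Lemma slope_small {K t e : R} : 0 < K + 1 -> 0 <= t -> t <= e / (K + 1) ->
  K * t <= e.
Proof.
move=> K0 t0; rewrite ler_pdivlMr // => te; apply: le_trans te.
by rewrite mulrC ler_wpM2l // lerDl.
Qed.

(** [F + h] and [F' + h'] are the envelope values at two points. The first two hypotheses test each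
    minimizer against the other, the next two are tangents of the penalty, and the last two place
    both slopes within [e] of the candidate [a]. *)
Lemma envelope_arith {F F' h h' hx hy up lo a e : R} :
  F' + h' <= F + hx -> F + h <= F' + hy -> hx + up <= h -> hy + lo <= h' ->
  - up <= a + e -> a - e <= lo ->
  `|F' + h' - (F + h) - a| <= e.
Proof. by move=> *; rewrite ler_norml; apply/andP; split; lra. Qed.

End SlopeArithmetic.

(** * Subgradients at proximal points and the gradient of the envelope *)

Section Prox.
Context {R : realType} {n : nat} {p gamma : R} {f : 'rV[R]_n -> \bar R}.
Context (p2 : 2 <= p) (gamma0 : 0 < gamma).
Implicit Types (u v x y z : 'rV[R]_n).

Let p0 : 0 < p. Proof. exact: lt_le_trans p2. Qed.
Let p1 : 1 < p. Proof. by apply: lt_le_trans p2; rewrite ltr1n. Qed.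
Let pg0 : 0 < p * gamma. Proof. exact: mulr_gt0. Qed.

Let lip_ge0 (r : R) : 0 <= (p - 1) * r `^ (p - 2) / gamma.
Proof.
apply: divr_ge0; last exact: ltW.
by rewrite mulr_ge0 ?powR_ge0 // subr_ge0 ltW.
Qed.

Definition penalty u := enorm u `^ p / (p * gamma).
Definition penalty_grad u := gamma^-1 *: powmap p u.

Lemma penalty_tangent u v :
  penalty u + dot (penalty_grad u) (v - u) <= penalty v.
Proof.
rewrite /penalty ler_pdivlMr // mulrDl mulfVK ?gt_eqF // dotZl.
have -> : gamma^-1 * dot (powmap p u) (v - u) * (p * gamma) =
    p * dot (powmap p u) (v - u) by field; rewrite gt_eqF.
exact: powmap_tangent.
Qed.

Lemma penalty_grad_lipschitz r u v : enorm u <= r -> enorm v <= r ->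
  enorm (penalty_grad u - penalty_grad v) <=
    (p - 1) * r `^ (p - 2) / gamma * enorm (u - v).
Proof.
move=> ur vr; rewrite -scalerBr enormZ gtr0_norm ?invr_gt0 // mulrC.
by rewrite mulrAC ler_pM2r ?invr_gt0 // powmap_lipschitz.
Qed.

Lemma penalty_grad_dot r u v w : enorm u <= r -> enorm v <= r ->
  `|dot (penalty_grad u - penalty_grad v) w| <=
    (p - 1) * r `^ (p - 2) / gamma * enorm (u - v) * enorm w.
Proof.
move=> ur vr; apply: (@le_trans _ _
  (enorm (penalty_grad u - penalty_grad v) * enorm w)).
  by rewrite ler_norml dot_geN dot_le.
by rewrite ler_wpM2r ?enorm_ge0 // penalty_grad_lipschitz.
Qed.

Lemma prox_objE x y : prox_obj f p gamma x y = (f y + (penalty (x - y))%:E)%E.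
Proof. by []. Qed.

Lemma prox_fine x y z : prox f p gamma x y -> f y \is a fin_num ->
  f z \is a fin_num ->
  fine (f y) + penalty (x - y) <= fine (f z) + penalty (x - z).
Proof.
move=> /(_ z) + fy fz.
by rewrite !prox_objE -(fineK fy) -(fineK fz) -!EFinD lee_fin.
Qed.

Lemma envelope_prox x y : prox f p gamma x y -> f y \is a fin_num ->
  envelope f p gamma x = (fine (f y) + penalty (x - y))%:E.
Proof.
move=> xy fy; rewrite EFinD fineK // -prox_objE; apply/eqP; rewrite eq_le.
apply/andP; split; first by apply: ereal_inf_lbound; exists y.
by apply: le_ereal_inf_tmp => _ [z _ <-]; exact: xy.
Qed.

Lemma prox_fin_num x y : (forall z, f z != -oo%E) ->
  (exists z, f z \is a fin_num) -> prox f p gamma x y -> f y \is a fin_num.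
Proof.
move=> fNy [z fz] /(_ z).
rewrite !prox_objE -(fineK fz) -EFinD fin_numE fNy /=.
by case: (f y).
Qed.

(* The tangent of the penalty at [x - z] bounds [f z] from below with slope
   [penalty_grad (x - z)], which is close to [penalty_grad (x - y)]. *)
Lemma prox_regular_subdiff x y : f y \is a fin_num -> prox f p gamma x y ->
  regular_subdiff f y (penalty_grad (x - y)).
Proof.
move=> fy xy; split=> // e e0.
(* The ball of radius [r] contains [x - z] whenever [|z - y| < 1], and [K] is the Lipschitz constant
   of [penalty_grad] there. *)
pose r := enorm (x - y) + 1; pose K := (p - 1) * r `^ (p - 2) / gamma.
have K0 : 0 < K + 1 by apply: ltr_wpDl => //; exact: lip_ge0.
exists (Num.min 1 (e / (K + 1))); split; first by rewrite lt_min ltr01 divr_gt0.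
move=> z; rewrite lt_min => /andP[z1 ze].
have [fz|fz] := boolP (f z \is a fin_num); last first.
  have := xy z; rewrite !prox_objE -(fineK fy) -EFinD.
  by move: fz; case: (f z) => // _ _; rewrite leey.
rewrite -[in f z](fineK fz) lee_fin.
have zr : enorm (x - z) <= r.
  apply: le_trans (enorm_dist _ y _) _; rewrite lerD2l enormB; exact: ltW.
have yr : enorm (x - y) <= r by rewrite lerDl ler01.
have := penalty_grad_dot r (x - z) (x - y) (z - y) zr yr.
rewrite dotBl ler_norml => /andP[slope _].
have tang := penalty_tangent (x - z) (x - y).
rewrite subDB in tang; rewrite subDB in slope; rewrite (enormB y) in slope.
apply: slope_arith (prox_fine x y z xy fy fz) tang slope _.
apply: ler_wpM2r; first exact: enorm_ge0.
exact: slope_small K0 (enorm_ge0 _) (ltW ze).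
Qed.

(** The increment of the envelope lies between the penalty slopes at [x - y'] and [x' - y]. Both
    tend to the slope at [x - y]: the second as [x'] tends to [x], the first because [cont] brings
    [y'] close to [y]. *)
Lemma prox_has_gradient x y : (forall z, f z != -oo%E) ->
  f y \is a fin_num -> prox f p gamma x y ->
  (forall e : R, 0 < e -> exists d : R, 0 < d /\ forall x', enorm (x' - x) < d ->
     exists y', prox f p gamma x' y' /\ enorm (y' - y) <= e) ->
  has_gradient (envelope f p gamma) x (penalty_grad (x - y)).
Proof.
move=> fNy fy xy cont; rewrite /has_gradient (envelope_prox x y xy fy).
split=> // e e0.
pose r := enorm (x - y) + 1; pose K := (p - 1) * r `^ (p - 2) / gamma.
have K0 : 0 < K + 1 by apply: ltr_wpDl => //; exact: lip_ge0.
have m0 : 0 < Num.min 1 (e / (K + 1)) by rewrite lt_min ltr01 divr_gt0.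
have [d [d0 dP]] := cont _ m0.
exists (Num.min d (Num.min 1 (e / (K + 1)))); split; first by rewrite lt_min d0.
move=> x'; rewrite !lt_min => /and3P[/dP[y' [xy' yy']] x1 xe].
have fy' : f y' \is a fin_num by apply: (prox_fin_num x') => //; exists y.
rewrite (envelope_prox x' y' xy' fy'); split=> //=.
move: yy'; rewrite le_min => /andP[y1 ye].
have yr : enorm (x - y) <= r by rewrite lerDl ler01.
have slope t : t <= e / (K + 1) -> 0 <= t ->
    K * t * enorm (x' - x) <= e * enorm (x' - x).
  move=> te t0; apply: ler_wpM2r; first exact: enorm_ge0.
  exact: slope_small K0 t0 te.
apply: envelope_arith (prox_fine x' y' y xy' fy' fy) (prox_fine x y y' xy fy fy')
  (penalty_tangent (x' - y) (x - y)) (penalty_tangent (x - y') (x' - y')) _ _.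
(* Upper bound: [y] competes at [x'], and the slope error is governed by [|x' - x|]. *)
- rewrite subDBr -(opprB x') dotNr opprK.
  have xr : enorm (x' - y) <= r.
    by apply: le_trans (enorm_dist _ x _) _; rewrite addrC lerD2l ltW.
  have := penalty_grad_dot r (x' - y) (x - y) (x' - x) xr yr.
  rewrite subDBr ler_norml dotBl => /andP[_]; rewrite lerBlDl => /le_trans; apply.
  by rewrite lerD2l; apply: slope (ltW xe) (enorm_ge0 _).
(* Lower bound: [y'] competes at [x], and the slope error is governed by [|y' - y|]. *)
- rewrite subDBr.
  have xr : enorm (x - y') <= r.
    by apply: le_trans (enorm_dist _ y _) _; rewrite lerD2l enormB.
  have := penalty_grad_dot r (x - y') (x - y) (x' - x) xr yr.
  rewrite subDB (enormB y) ler_norml dotBl => /andP[+ _].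
  rewrite lerBrDl; apply: le_trans; rewrite lerD2l lerN2.
  exact: slope ye (enorm_ge0 _).
Qed.

End Prox.
Arguments penalty {R n} p gamma u.
Arguments penalty_grad {R n} p gamma u.

Lemma lte_EFinDr {R : realType} (a h : R) (u : \bar R) :
  (a%:E < u + h%:E)%E = ((a - h)%:E < u)%E.
Proof. by case: u => [r||] /=; rewrite ?ltry ?ltNyr ?lte_fin ?ltrBlDr. Qed.

(** * Coercivity from calmness; existence and location of minimizers *)

Section Coercive.
Context {R : realType} {n : nat} {p gamma M : R} {f : 'rV[R]_n -> \bar R}.
Context (p2 : 2 <= p) (gamma0 : 0 < gamma) (M0 : 0 < M).
Context (gammaM : M * 2 `^ (p - 1) < (p * gamma)^-1).
Context (f0 : f 0 = 0%E).
Context (f_ge : forall z, ((- (M * enorm z `^ p))%:E <= f z)%E).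
Implicit Types (x y z : 'rV[R]_n).

Let p0 : 0 < p. Proof. exact: lt_le_trans p2. Qed.
Let p1 : 1 < p. Proof. by apply: lt_le_trans p2; rewrite ltr1n. Qed.

(** The constant C in [|x - y| <= C |x|]. With [A = 1 / (p gamma)] and [B = M 2 ^ (p - 1)], it
    solves [(A - B) C ^ p - B = A], the lower bound of [prox_obj_ge] set equal to the objective at
    0, for [|x| = 1]. *)
Definition prox_radius : R :=
  (((p * gamma)^-1 + M * 2 `^ (p - 1)) /
   ((p * gamma)^-1 - M * 2 `^ (p - 1))) `^ p^-1.

(** Calmness costs at most [M |z| ^ p]; writing [z = x - (x - z)], [powRD_le] charges this to
    [|x| ^ p] and to [|x - z| ^ p], where the penalty outweighs it. *)
Lemma prox_obj_ge x z :
  ((((p * gamma)^-1 - M * 2 `^ (p - 1)) * enorm (x - z) `^ p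
     - M * 2 `^ (p - 1) * enorm x `^ p)%:E <= prox_obj f p gamma x z)%E.
Proof.
have zp : enorm z `^ p <= 2 `^ (p - 1) * (enorm x `^ p + enorm (x - z) `^ p).
  apply: le_trans (powRD_le (enorm_ge0 _) (enorm_ge0 _) p1).
  apply: ler_powR_base (ltW p0) (enorm_ge0 _) _.
  by have := enormB_le x (x - z); rewrite opprB addrC subrK.
apply: (@le_trans _ _ ((- (M * enorm z `^ p))%:E + (penalty p gamma (x - z))%:E)%E).
  rewrite -EFinD lee_fin /penalty.
  move: zp => /(ler_wpM2l (ltW M0)).
  move: (enorm z `^ p) (enorm x `^ p) (enorm (x - z) `^ p) (_ `^ _) => a b c d.
  lra.
by rewrite leeD2r.
Qed.

Lemma prox_obj0 x : prox_obj f p gamma x 0 = (enorm x `^ p / (p * gamma))%:E.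
Proof. by rewrite /prox_obj f0 add0e subr0. Qed.

(** Stated for the whole sublevel set of the value at 0, so that it both confines the search for a
    minimizer and locates every minimizer. *)
Lemma prox_obj_sublevel x z :
  (prox_obj f p gamma x z <= prox_obj f p gamma x 0)%E ->
  enorm (x - z) <= prox_radius * enorm x.
Proof.
move=> /(le_trans (prox_obj_ge x z)); rewrite prox_obj0 lee_fin.
rewrite leNgt => H; rewrite leNgt; apply: contra H => H.
have AB := gammaM.
set B := M * _ in AB *; set A := (p * gamma)^-1 in AB *.
have B0 : 0 < B by rewrite mulr_gt0 ?powR_gt0.
have A0 : 0 < A by apply: lt_trans AB.
have rad0 : 0 <= prox_radius * enorm x by rewrite mulr_ge0 ?powR_ge0 ?enorm_ge0.
have := @gt0_ltr_powR _ _ p0 _ _ _ _ H; rewrite !nnegrE.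
rewrite rad0 enorm_ge0 => /(_ erefl erefl).
rewrite powRM ?powR_ge0 ?enorm_ge0 // -powRrM mulVf ?gt_eqF // powRr1; last first.
  by apply: divr_ge0; [exact: addr_ge0 (ltW A0) (ltW B0) | rewrite subr_ge0 ltW].
rewrite mulrAC -/A -/B ltr_pdivrMr ?subr_gt0 //.
move: (enorm x `^ p) (enorm _ `^ p) => a b; lra.
Qed.

Lemma prox_near x y : prox f p gamma x y -> enorm (x - y) <= prox_radius * enorm x.
Proof. by move=> xy; apply: prox_obj_sublevel. Qed.

Lemma prox_le0 x y : prox f p gamma x y ->
  (f y <= (enorm x `^ p / (p * gamma))%:E)%E.
Proof.
move=> /(_ 0); rewrite prox_obj0; apply: le_trans; rewrite leeDl // lee_fin.
by rewrite divr_ge0 ?powR_ge0 // mulr_ge0 // ltW.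
Qed.

Lemma lsc_prox_obj x : lsc f -> lsc (prox_obj f p gamma x).
Proof.
move=> lf y a ay; have {ay} /lte_EFin_dense[b [ab bf]] :
  ((a - penalty p gamma (x - y))%:E < f y)%E by rewrite -lte_EFinDr.
have [d [d0 df]] := lf y b bf.
(* Only a lower bound on the penalty is needed, and its tangent at [x - y] supplies one; the gap
   created by [b] absorbs the linear term. *)
pose g := penalty_grad p gamma (x - y).
have g0 : 0 < enorm g + 1 by rewrite ltr_wpDl // enorm_ge0.
have s0 : 0 < b - (a - penalty p gamma (x - y)) by rewrite subr_gt0.
exists (Num.min d ((b - (a - penalty p gamma (x - y))) / (enorm g + 1))).
split; first by rewrite lt_min d0 divr_gt0.
move=> z; rewrite lt_min => /andP[/df bz]; rewrite ltr_pdivlMr // => zy.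
rewrite prox_objE lte_EFinDr; apply: le_lt_trans bz; rewrite lee_fin.
have := penalty_tangent p2 gamma0 (x - y) (x - z).
have := dot_geN g (y - z); rewrite -/g subDB (enormB y).
have := enorm_ge0 (z - y).
move: (penalty _ _ _) (penalty _ _ _) (dot _ _) (enorm _) (enorm _) zy.
move=> h1 h2 t u v; lra.
Qed.

Lemma prox_nonempty x : lsc f -> exists y, prox f p gamma x y.
Proof.
(* By [|z| <= |x| + |x - z|], the box of half-width [B] contains every point whose objective is at
   most the value at 0, so a minimizer over the box is global. *)
move=> lf; pose B := prox_radius * enorm x + enorm x.
have B0 : 0 <= B by rewrite addr_ge0 ?mulr_ge0 ?powR_ge0 ?enorm_ge0.
have cK : compact [set z : 'rV[R]_n | forall i, `[- B, B]%classic (z ord0 i)].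
  by apply: (@rV_compact R n (fun=> `[- B, B]%classic)) => _; exact: segment_compact.
have K0 : [set z : 'rV[R]_n | forall i, `[- B, B]%classic (z ord0 i)] 0.
  by move=> i /=; rewrite mxE in_itv /= oppr_le0 B0.
have fin0 : prox_obj f p gamma x 0 \is a fin_num by rewrite prox_obj0.
have [|y Ky ymin] := lsc_attains_min 0 (- (M * 2 `^ (p - 1) * enorm x `^ p))
    (lsc_prox_obj x lf) cK K0 fin0.
  move=> z _; apply: le_trans (prox_obj_ge x z); rewrite lee_fin lerDr.
  by rewrite mulr_ge0 ?powR_ge0 // subr_ge0 ltW.
exists y => z; have [Kz|nKz] := pselect (forall i, `[- B, B]%classic (z ord0 i)).
  exact: ymin.
apply: le_trans (ymin _ K0) _; rewrite leNgt; apply/negP => /ltW zx.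
apply: nKz => i /=; rewrite in_itv /= -ler_norml.
apply: le_trans (enorm_coord _ _) _.
have := enormB_le x (x - z); rewrite opprB addrC subrK => /le_trans; apply.
by rewrite addrC lerD2r prox_obj_sublevel.
Qed.

End Coercive.

(** * The Hölder estimate for proximal points *)

Section Holder.
Context {R : realType} {n : nat} {p gamma : R}.
Context (p2 : 2 <= p) (gamma0 : 0 < gamma).

Lemma powR_rootK {d q : R} : 0 <= d -> 0 < q -> (d `^ q) `^ (1 / q) = d.
Proof.
by move=> d0 q0; rewrite -powRrM mulrC divfK ?gt_eqF // powRr1.
Qed.

Lemma powR_root_le {d q w N t : R} : 0 <= d -> 0 < q -> 0 < w -> 0 <= N ->
  0 <= t -> w * d `^ q <= N * t -> d <= (N / w) `^ (1 / q) * t `^ (1 / q).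
Proof.
move=> d0 q0 w0 N0 t0 H.
rewrite -powRM ?divr_ge0 // ?(ltW w0) //.
rewrite -[leLHS](powR_rootK d0 q0).
apply: ler_powR_base; [by rewrite divr_ge0 // ltW|exact: powR_ge0|].
by rewrite mulrAC ler_pdivlMr // mulrC.
Qed.

(* [x1 - y2] is the pivot: passing from it to [x1 - y1] is controlled from below
   by uniform monotonicity, passing from it to [x2 - y2] from above by the
   Lipschitz bound. *)
Lemma prox_holder_estimate {x1 x2 y1 y2 : 'rV[R]_n} {r rho q : R} : p <= q ->
  enorm (y2 - y1) <= 1 -> enorm (x2 - y2) <= r -> enorm (x1 - y2) <= r ->
  - (rho * enorm (y2 - y1) `^ q) <=
    dot (penalty_grad p gamma (x2 - y2) - penalty_grad p gamma (x1 - y1))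
      (y2 - y1) ->
  (2 `^ (1 - p) - gamma * rho) * enorm (y2 - y1) `^ q <=
    (p - 1) * r `^ (p - 2) * enorm (x2 - x1) * enorm (y2 - y1).
Proof.
move=> pq; have := enorm_ge0 (y2 - y1); set d := enorm (y2 - y1) => d0 d1 r2 r1.
have p0 : 0 < p by apply: lt_le_trans p2.
(* Since [d <= 1], the monotonicity gain of order [p] dominates one of order [q], comparable with
   the prox-regularity loss. *)
have dpq : d `^ q <= d `^ p.
  move: d0; rewrite le_eqVlt => /predU1P[<-|d0].
    by rewrite !powR0 ?gt_eqF // (lt_le_trans p0).
  by apply: ger_powR => //; rewrite d0.
rewrite -scalerBr dotZl [gamma^-1 * _]mulrC ler_pdivlMr // => upper.
have := powmap_monotone p2 (x1 - y1) (x1 - y2).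
rewrite subDB -/d => mono.
have lip : dot (powmap p (x2 - y2) - powmap p (x1 - y2)) (y2 - y1) <=
    (p - 1) * r `^ (p - 2) * enorm (x2 - x1) * d.
  apply: le_trans (dot_le _ _) _; rewrite ler_wpM2r //.
  by have := powmap_lipschitz p2 r _ _ r2 r1; rewrite subDBr.
have split_dot : dot (powmap p (x2 - y2) - powmap p (x1 - y2)) (y2 - y1) =
    dot (powmap p (x2 - y2) - powmap p (x1 - y1)) (y2 - y1) +
    dot (powmap p (x1 - y1) - powmap p (x1 - y2)) (y2 - y1).
  by rewrite -dotDl addrA subrK.
have mono_q : 2 `^ (1 - p) * d `^ q <= 2 `^ (1 - p) * d `^ p.
  by rewrite ler_wpM2l ?powR_ge0.
apply: le_trans lip; rewrite split_dot.
apply: le_trans (lerD upper (le_trans mono_q mono)).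
by rewrite le_eqVlt; apply/orP; left; apply/eqP; ring.
Qed.

End Holder.

(** * Comparison with the constants of the theorem *)

Section Constants.
Context {R : realType}.

Lemma calm_constant_small {p M gamma : R} : 2 <= p -> 0 < M -> 0 < gamma ->
  gamma < 2 `^ (1 - p) / (M * p) -> M * 2 `^ (p - 1) < (p * gamma)^-1.
Proof.
move=> p2 M0 gamma0; have p0 : 0 < p by apply: lt_le_trans p2.
rewrite ltr_pdivlMr ?mulr_gt0 // -(opprB p) powRN => H.
rewrite -[_^-1]mul1r ltr_pdivlMr ?mulr_gt0 //.
move: H; rewrite -[_^-1]mul1r ltr_pdivlMr ?powR_gt0 //.
apply: le_lt_trans; rewrite le_eqVlt; apply/orP; left; apply/eqP; ring.
Qed.

(** Passes from the monotonicity constant to the smaller one in [Lp], as [3 - 2 p <= 1 - p]. *)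
Lemma two_pow_le {p : R} : 2 <= p -> 1 / 2 `^ (2 * p - 3) <= 2 `^ (1 - p) :> R.
Proof. by move=> p2; rewrite mul1r -powRN ler_powR ?ler1n //; lra. Qed.

(** Factor [t = t ^ ((q - 1) / q) * t ^ (1 / q)] and bound the first factor; this turns a Lipschitz
    term on a bounded set into a Hölder one. *)
Lemma holder_split {t b q : R} : 1 <= q -> 0 <= t -> t <= b ->
  t <= b `^ ((q - 1) / q) * t `^ (1 / q).
Proof.
move=> q1 t0 tb; have q0 : 0 < q by apply: lt_le_trans q1.
have qE : (q - 1) / q + 1 / q = 1 by field; rewrite gt_eqF.
apply: (@le_trans _ _ (t `^ ((q - 1) / q) * t `^ (1 / q))).
  by rewrite -powRD qE ?powRr1 // oner_eq0.
by rewrite ler_wpM2r ?powR_ge0 // ler_powR_base // divr_ge0 ?subr_ge0 // ltW.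
Qed.

Lemma kappa_const_le {k c : R} : 0 < k -> 1 <= c ->
  k^-1 <= 2 * (1 + c / k).
Proof.
move=> k0 c1; have ik : 0 < k^-1 by rewrite invr_gt0.
have : k^-1 <= c / k by rewrite ler_peMl // ltW.
lra.
Qed.

Lemma monotone_arith {F1 F2 a b rho D : R} :
  F1 + a - rho / 2 * D <= F2 -> F2 + - b - rho / 2 * D <= F1 ->
  - (rho * D) <= b - a.
Proof. lra. Qed.

End Constants.

(** * Use of the hypotheses on [phi], and assembly of the theorem *)

Lemma calm_lower_bound {R : realType} {n : nat} {p M : R}
    {f : 'rV[R]_n -> \bar R} : p != 0 -> p_calm f 0 p M -> f 0 = 0%E ->
  forall z, ((- (M * enorm z `^ p))%:E <= f z)%E.
Proof.
move=> pn0 calm f0 z; have [->|/calm] := eqVneq z 0.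
  by rewrite enorm0 powR0 // mulr0 oppr0 f0.
rewrite f0 subr0; case: (f z) => [r||] //; last by rewrite leey.
by rewrite -EFinD lte_fin lee_fin => /ltW; rewrite -lerBlDr sub0r.
Qed.

Lemma regular_limiting_subdiff {R : realType} {n : nat}
    {f : 'rV[R]_n -> \bar R} {x v : 'rV[R]_n} :
  regular_subdiff f x v -> limiting_subdiff f x v.
Proof.
move=> xv; split; first by case: xv.
exists (fun=> x), (fun=> v); split; last split; last split => //.
- by move=> e e0; exists 0%N => k _; rewrite subrr enorm0.
- by move=> e e0; exists 0%N => k _; rewrite subrr normr0.
- by move=> e e0; exists 0%N => k _; rewrite subrr enorm0.
Qed.

Theorem theorem8 (R : realType) (n : nat) (that : R) (Hthat : that_eqn that)
  (phi : 'rV[R]_n -> \bar R) (p q M eps rho : R) :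
  2 <= p -> proper_fun phi -> lsc phi ->
  0 < M -> p_calm phi 0 p M -> phi 0 = 0%E ->
  p <= q -> 0 < eps -> eps < 1 / 2 -> 0 < rho ->
  q_prox_regular phi 0 0 q eps rho ->
  forall gamma : R, 0 < gamma ->
    gamma < Num.min (2 `^ (1 - p) / (M * p)) (1 / (rho * 2 `^ (2 * p - 3))) ->
  let s := p / (p - 1) in
  let Lp := (2 * (1 + 2 `^ p / kappa that s) * eps `^ (p - 1)
               / (1 / 2 `^ (2 * p - 3) - gamma * rho)) `^ (1 / q) in
  let cLp := 2 * (2 * eps) `^ (p - 2) / (gamma * kappa that s)
               * ((2 * eps) `^ ((q - 1) / q) + Lp) in
  exists delta : R, 0 < delta /\ delta <= eps /\
    let U := [set x : 'rV[R]_n | enorm x < delta] in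
    (forall x, U x -> exists y, prox phi p gamma x y) /\
    (forall x1 x2 y1 y2, U x1 -> U x2 ->
       prox phi p gamma x1 y1 -> prox phi p gamma x2 y2 ->
       enorm (y2 - y1) <= Lp * enorm (x2 - x1) `^ (1 / q)) /\
    exists G : 'rV[R]_n -> 'rV[R]_n,
      (forall x, U x -> has_gradient (envelope phi p gamma) x (G x)) /\
      (forall x1 x2, U x1 -> U x2 ->
         enorm (G x2 - G x1) <= cLp * enorm (x2 - x1) `^ (1 / q)).
Proof.
move=> p2 [fNy fproper] lf M0 calm f0 pq eps0 eps12 rho0 [_ preg] gamma gamma0.
rewrite lt_min => /andP[gM grho] s Lp cLp.
have p0 : 0 < p by apply: lt_le_trans p2.
have p1 : 1 < p by apply: lt_le_trans p2; rewrite ltr1n.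
have q0 : 0 < q by apply: lt_le_trans pq.
have gammaM := calm_constant_small p2 M0 gamma0 gM.
have f_ge := calm_lower_bound (lt0r_neq0 p0) calm f0.
have [kappa0 kappa1] := kappa_le (that := that) p2; rewrite -/s in kappa0 kappa1.
have ikappa : p - 1 <= (kappa that s)^-1 by rewrite -[leRHS]mul1r ler_pdivlMr.
have w0 : 0 < 1 / 2 `^ (2 * p - 3) - gamma * rho.
  rewrite subr_gt0 ltr_pdivlMr ?powR_gt0 //.
  by move: grho; rewrite ltr_pdivlMr ?mulr_gt0 ?powR_gt0 // mulrA.
pose rad : R := @prox_radius R p gamma M.
have rad0 : 0 <= rad by exact: powR_ge0.
have rad1 : 0 < 1 + rad by rewrite ltr_pwDl.
have min0 : 0 < Num.min eps (gamma * eps) by rewrite lt_min eps0 mulr_gt0.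
(* On [U], [(1 + rad) |x|] is at most half of [eps] and of [gamma * eps]: the first keeps [x] and
   its minimizers within [eps / 2], the second keeps the subgradient and the value of [phi] within
   the reach of prox-regularity. *)
pose delta := Num.min eps (gamma * eps) / (2 * (1 + rad)); exists delta.
have delta0 : 0 < delta by rewrite divr_gt0 // mulr_gt0.
have deltaE (t : R) : 0 <= t -> t < delta ->
    [/\ t + rad * t <= eps / 2 & t + rad * t <= gamma * eps / 2].
  move=> t0; rewrite /delta ltr_pdivlMr ?mulr_gt0 // lt_min => /andP[].
  by rewrite mulrCA mulrDr mulr1 (mulrC t); split; lra.
split=> //; split.
  rewrite ler_pdivrMr ?mulr_gt0 //; apply: (@le_trans _ _ eps).
    by rewrite ge_min lexx.
  by rewrite ler_peMr ?ltW //; lra.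
set U := [set x | _] => /=.
have local x y : U x -> prox phi p gamma x y ->
    [/\ phi y \is a fin_num, enorm x <= eps / 2, enorm y <= eps / 2
      & forall z, phi z \is a fin_num -> enorm z <= eps / 2 ->
        fine (phi y) + dot (penalty_grad p gamma (x - y)) (z - y)
          - rho / 2 * enorm (z - y) `^ q <= fine (phi z)].
  move=> Ux xy; have x0 := enorm_ge0 x.
  have [be bg] := deltaE _ x0 Ux.
  have rx0 : 0 <= rad * enorm x by rewrite mulr_ge0.
  have xyr : enorm (x - y) <= rad * enorm x.
    exact: (prox_near p2 M0 gammaM f0 f_ge x y xy).
  have yb : enorm y <= enorm x + rad * enorm x.
    have := enormB_le x (x - y); rewrite opprB addrC subrK => /le_trans; apply.
    by rewrite lerD2l.
  have fy : phi y \is a fin_num.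
    exact: (prox_fin_num _ _ fNy fproper xy).
  have ye : enorm y <= eps / 2 by apply: le_trans be.
  have eps2 : eps / 2 <= eps by lra.
  have xe : enorm x <= eps / 2 by apply: le_trans be; rewrite lerDl.
  split=> // z fz ze; rewrite -lee_fin (fineK fz) //; apply: preg; rewrite /cball /= ?subr0 //.
  - exact: le_trans eps2.
  - exact/regular_limiting_subdiff/(prox_regular_subdiff p2 gamma0).
  - rewrite enormZ gtr0_norm ?invr_gt0 // enorm_powmap //.
    rewrite mulrC ler_pdivrMr //.
    have xy1 : enorm (x - y) `^ (p - 1) <= enorm (x - y).
      by apply: powR_le_self; rewrite ?enorm_ge0 //; lra.
    by apply: le_trans xy1 _; lra.
  - apply: le_lt_trans (prox_le0 p2 gamma0 f0 _ _ xy) _; rewrite f0 add0e lte_fin.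
    rewrite ltr_pdivrMr ?mulr_gt0 //.
    have : enorm x `^ p <= enorm x by apply: powR_le_self => //; lra.
    move=> /le_lt_trans; apply.
    have : gamma * eps * 1 < gamma * eps * p by rewrite ltr_pM2l ?mulr_gt0.
    have : 0 < gamma * eps by rewrite mulr_gt0.
    by rewrite (mulrC p) mulrA (mulrC eps); lra.
  - exact: le_trans eps2.
have half_sum (u v : 'rV[R]_n) : enorm u <= eps / 2 -> enorm v <= eps / 2 ->
    enorm (u - v) <= eps.
  by move=> ue ve; apply: le_trans (enormB_le _ _) _; rewrite [leRHS]splitr lerD.
have holder x1 x2 y1 y2 : U x1 -> U x2 ->
    prox phi p gamma x1 y1 -> prox phi p gamma x2 y2 ->
    enorm (y2 - y1) <= Lp * enorm (x2 - x1) `^ (1 / q).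
  move=> Ux1 Ux2 xy1 xy2.
  have [f1 x1e y1e reg1] := local _ _ Ux1 xy1.
  have [f2 x2e y2e reg2] := local _ _ Ux2 xy2.
  have monotone : - (rho * enorm (y2 - y1) `^ q) <=
      dot (penalty_grad p gamma (x2 - y2) - penalty_grad p gamma (x1 - y1))
        (y2 - y1).
    move: (reg1 _ f2 y2e) (reg2 _ f1 y1e).
    rewrite -(opprB y2 y1) enormN dotNr dotBl; exact: monotone_arith.
  have de : enorm (y2 - y1) <= eps by exact: half_sum.
  have d1 : enorm (y2 - y1) <= 1.
    by apply: le_trans de _; apply: ltW; apply: lt_trans eps12 _; lra.
  apply: powR_root_le => //; try exact: enorm_ge0.
    by rewrite !mulr_ge0 ?addr_ge0 ?divr_ge0 ?powR_ge0 // ltW.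
  have := prox_holder_estimate p2 gamma0 pq d1 (half_sum _ _ x2e y2e)
    (half_sum _ _ x1e y2e) monotone.
  set d := enorm (y2 - y1) in de *; set t := enorm (x2 - x1) => core.
  apply: (@le_trans _ _ ((2 `^ (1 - p) - gamma * rho) * d `^ q)).
    by rewrite ler_wpM2r ?powR_ge0 // lerD2r two_pow_le.
  apply: le_trans core _.
  rewrite mulrAC ler_wpM2r ?enorm_ge0 //.
  (* The spare factor [d <= eps] raises [eps ^ (p - 2)] to [eps ^ (p - 1)]; then
     [p - 1 <= 1 / kappa] brings in the factor of [Lp]. *)
  apply: (@le_trans _ _ ((p - 1) * eps `^ (p - 1))).
    rewrite -(mulr_powRB2 (ltW eps0) p1) mulrA ler_wpM2l //.
    by rewrite mulr_ge0 ?powR_ge0 // subr_ge0 ltW.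
  rewrite ler_wpM2r ?powR_ge0 //; apply: le_trans ikappa _.
  by apply: kappa_const_le => //; rewrite -[leLHS](powRr0 2) ler_powR ?ler1n // ltW.
have [P PP] := choice (fun x =>
  prox_nonempty p2 gamma0 M0 gammaM f0 f_ge x lf).
split; first by move=> x _; exists (P x).
split=> //.
exists (fun x => penalty_grad p gamma (x - P x)); split.
  move=> x Ux; have [fPx _ _ _] := local _ _ Ux (PP x).
  apply: prox_has_gradient => // e e0.
  have Lp1 : 0 < Lp + 1 by rewrite ltr_wpDl ?powR_ge0.
  (* The first radius keeps [x'] in [U]; the second inverts the Hölder bound. *)
  exists (Num.min (delta - enorm x) ((e / (Lp + 1)) `^ q)).
  split; first by rewrite lt_min subr_gt0 Ux powR_gt0 ?divr_gt0.
  move=> x'; rewrite lt_min => /andP[xx' xe]; exists (P x'); split=> //.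
  have Ux' : U x'.
    rewrite /U /=; have := enormD (x' - x) x; rewrite subrK => /le_lt_trans; apply.
    by rewrite -ltrBrDr.
  apply: le_trans (holder _ _ _ _ Ux Ux' (PP x) (PP x')) _.
  have root : enorm (x' - x) `^ (1 / q) <= e / (Lp + 1).
    have e1 : 0 <= e / (Lp + 1) by rewrite divr_ge0 // ltW.
    rewrite -(powR_rootK e1 q0); apply: ler_powR_base; last exact: ltW.
      by rewrite divr_ge0 // ltW.
    exact: enorm_ge0.
  exact: slope_small Lp1 (powR_ge0 _ _) root.
move=> x1 x2 Ux1 Ux2.
have [_ x1e P1e _] := local _ _ Ux1 (PP x1).
have [_ x2e P2e _] := local _ _ Ux2 (PP x2).
have t0 := enorm_ge0 (x2 - x1).
have split_t := holder_split (ltW (lt_le_trans p1 pq)) t0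
  (le_trans (half_sum _ _ x2e x1e) (ler_peMl (ltW eps0) (ler1n R 2))).
have prox_t := holder _ _ _ _ Ux1 Ux2 (PP x1) (PP x2).
apply: le_trans (penalty_grad_lipschitz p2 gamma0 eps _ _
  (half_sum _ _ x2e P2e) (half_sum _ _ x1e P1e)) _.
have dist : enorm (x2 - P x2 - (x1 - P x1)) <=
    ((2 * eps) `^ ((q - 1) / q) + Lp) * enorm (x2 - x1) `^ (1 / q).
  have -> : x2 - P x2 - (x1 - P x1) = (x2 - x1) - (P x2 - P x1).
    by rewrite !opprB addrACA [in RHS]addrACA (addrC (- P x2)).
  by apply: le_trans (enormB_le _ _) _; rewrite mulrDl lerD.
rewrite /cLp -[leRHS]mulrA; apply: ler_pM dist; last 1 first.
(* The prefactor of [cLp] dominates the Lipschitz constant on the ball of radius [eps], since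
   [p - 1 <= 1 / kappa <= 2 / kappa] and [eps <= 2 * eps]. *)
- have -> : 2 * (2 * eps) `^ (p - 2) / (gamma * kappa that s) =
      2 / kappa that s * (2 * eps) `^ (p - 2) / gamma.
    by field; rewrite !gt_eqF.
  rewrite ler_pM2r ?invr_gt0 //.
  apply: ler_pM; rewrite ?powR_ge0 ?subr_ge0 ?(ltW p1) //.
    by apply: le_trans ikappa _; rewrite ler_peMl ?ler1n // invr_ge0 ltW.
  apply: ler_powR_base; rewrite ?subr_ge0 ?(ltW eps0) //.
  by rewrite ler_peMl ?ler1n // ltW.
- by rewrite divr_ge0 ?mulr_ge0 ?powR_ge0 ?subr_ge0 // ltW.
- exact: enorm_ge0.
Qed.
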